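(* Let $f$ be a ReLU network, $\mathcal{X}\subset\mathbb{R}^{n_0}$ an open set expressible by quadratic or linear constraints, and $\varepsilon\ge0$. The problem $(\underline{\mathcal{P}}_\infty)_\varepsilon$ defined in the context has the same optimal value as $$\begin{array}{ll}\displaystyle\max_{y,\sigma,x,u,\mu,\eta}&\sum_{i=1}^{n_L}\eta_iu_i\\ \text{s.t.}& y_k=M_k\,\mathrm{diag}(\sigma_{k-1})\,y_{k-1},\quad k=2,\dots,L,\\ & y_1=M_1y_0,\\ & x_k=\sigma_k\odot(M_kx_{k-1}+b_k),\quad k=1,\dots,L-1,\\ & (\sigma_k-\tfrac12)\odot(M_kx_{k-1}+b_k)\ge\varepsilon,\quad k=1,\dots,L-1,\\ & \sigma_k\in\{0,1\}^{n_k},\quad k=1,\dots,L-1,\\ & x_0\in\mathcal{X},\\ & -1\le y_0\le1,\\ & \mu\in\{0,1\}^{n_L},\quad u\ge0,\\ & u_i=(2\mu_i-1)(y_L)_i,\quad i=1,\dots,n_L,\\ & \eta\in\{0,1\}^{n_L},\quad \sum_{i=1}^{n_L}\eta_i=1,\end{array}$$ where $u\in\mathbb{R}^{n_L}$.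
   Context: Network data: $f:\mathbb{R}^{n_0}\to\mathbb{R}^{n_L}$, $f=T_L\circ\rho_{L-1}\circ T_{L-1}\circ\cdots\circ\rho_1\circ T_1$, where $T_k(x)=M_kx+b_k$ maps $\mathbb{R}^{n_{k-1}}$ to $\mathbb{R}^{n_k}$ and $\rho_k$ applies $\mathrm{ReLU}(t)=\max(t,0)$ componentwise. Problem $(\underline{\mathcal{P}}_\infty)_\varepsilon$: maximize $\|y_L\|_\infty$ over $y=(y_0,\dots,y_L)$, $\sigma=(\sigma_1,\dots,\sigma_{L-1})$, $x=(x_0,\dots,x_{L-1})$ with $y_k,x_k\in\mathbb{R}^{n_k}$, subject to: $y_k=M_k\,\mathrm{diag}(\sigma_{k-1})y_{k-1}$ for $k=2,\dots,L$; $y_1=M_1y_0$; $x_k=\sigma_k\odot(M_kx_{k-1}+b_k)$, $(\sigma_k-\tfrac12)\odot(M_kx_{k-1}+b_k)\ge\varepsilon$ and $\sigma_k\in\{0,1\}^{n_k}$ for $k=1,\dots,L-1$; $x_0\in\mathcal{X}$; $\|y_0\|_\infty\le1$. $\odot$ is the Hadamard (componentwise) product; $\sigma_k-\tfrac12$ subtracts $\tfrac12$ from each component; vector inequalities are componentwise; $(v)_i$ is the $i$-th component of $v$. The optimal value of an infeasible maximization problem is $-\infty$. *)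

(* Defs.v *)
From HB Require Import structures.
From mathcomp Require Import all_boot all_order all_algebra.
From mathcomp Require Import all_classical all_reals all_analysis.

Set Implicit Arguments.
Unset Strict Implicit.
Unset Printing Implicit Defensive.

Import Order.TTheory GRing.Theory Num.Theory.
Import numFieldNormedType.Exports.

Local Open Scope classical_set_scope.
Local Open Scope ring_scope.

(* Layer-indexed families are total functions of k : nat. A network consists of
   the data with index in the range meaningful for a network of depth L; the
   other values (e.g. weight 0, bias 0, anything at k > L) are never
   referred to. Vectors of R^m are column vectors. *)
Record relu_network (R : realType) := ReluNetwork {
  depth : nat;
  width : nat -> nat;
  depth_gt0 : (0 < depth)%N;
  width_gt0 : forall k, (k <= depth)%N -> (0 < width k)%N;
  weight : forall k, 'M[R]_(width k, width k.-1);
  bias : forall k, 'cV[R]_(width k)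
}.

(* T_k, for 1 <= k <= L *)
Definition affine (R : realType) (f : relu_network R) (k : nat)
    (v : 'cV[R]_(width f k.-1)) : 'cV[R]_(width f k) :=
  weight f k *m v + bias f k.

Definition relu (R : realType) (m : nat) (v : 'cV[R]_m) : 'cV[R]_m :=
  map_mx (fun t : R => Num.max t 0) v.

Fixpoint hidden (R : realType) (f : relu_network R) (v : 'cV[R]_(width f 0))
    (k : nat) : 'cV[R]_(width f k) :=
  if k is k'.+1 then relu (affine (k := k'.+1) (hidden v k')) else v.

Definition network_fun (R : realType) (f : relu_network R)
    (v : 'cV[R]_(width f 0)) : 'cV[R]_(width f (depth f)) :=
  affine (hidden v (depth f).-1).

Coercion network_fun : relu_network >-> Funclass.

(* Strict relations are included because the described sets are to be open. *)
Variant constraint_rel := CLe | CLt | CEq.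

Definition holds_rel (R : realType) (r : constraint_rel) (t : R) : Prop :=
  match r with CLe => t <= 0 | CLt => t < 0 | CEq => t = 0 end.

(* The constraint  v^T Q v + c^T v + d  (<=, <, =)  0; it is linear if Q = 0. *)
Record quad_constraint (R : realType) (m : nat) := QuadConstraint {
  qc_quad : 'M[R]_m;
  qc_lin : 'cV[R]_m;
  qc_const : R;
  qc_rel : constraint_rel
}.

Definition satisfies (R : realType) (m : nat) (q : quad_constraint R m)
    (v : 'cV[R]_m) : Prop :=
  holds_rel (qc_rel q)
    ((v^T *m qc_quad q *m v) 0 0 + ((qc_lin q)^T *m v) 0 0 + qc_const q).

Definition quadratically_expressible (R : realType) (m : nat)
    (X : set 'cV[R]_m) : Prop :=
  exists (N : nat) (q : 'I_N -> quad_constraint R m),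
    X = [set v | forall j, satisfies (q j) v].

(* The supremum in the extended reals; it is -oo if the problem is infeasible. *)
Definition optimal_value (R : realType) (T : Type) (feasible : set T)
    (objective : T -> R) : \bar R :=
  ereal_sup [set (objective z)%:E | z in feasible].

Definition hadamard (R : realType) (m : nat) (v w : 'cV[R]_m) : 'cV[R]_m :=
  map2_mx *%R v w.

Definition binary (R : realType) (m : nat) (v : 'cV[R]_m) : Prop :=
  forall i, v i 0 = 0 \/ v i 0 = 1.

(* Only y_0, ..., y_L, sigma_1, ..., sigma_(L-1) and x_0, ..., x_(L-1) are
   variables of the problems: the other components are unconstrained and do
   not enter the objectives, so they have no effect on the optimal values. *)
Record net_var (R : realType) (f : relu_network R) := NetVar {
  var_y : forall k, 'cV[R]_(width f k);
  var_sigma : forall k, 'cV[R]_(width f k);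
  var_x : forall k, 'cV[R]_(width f k)
}.

(* The constraints shared by both problems, i.e. all those on (y, sigma, x)
   except the bound on y_0. *)
Record net_constraints (R : realType) (f : relu_network R)
    (X : set 'cV[R]_(width f 0)) (eps : R) (z : net_var f) : Prop :=
  NetConstraints {
  nc_y : forall k, (2 <= k <= depth f)%N ->
    var_y z k = weight f k *m diag_mx (var_sigma z k.-1)^T *m var_y z k.-1;
  nc_y1 : var_y z 1 = weight f 1 *m var_y z 0;
  nc_x : forall k, (1 <= k <= (depth f).-1)%N ->
    var_x z k = hadamard (var_sigma z k) (affine (var_x z k.-1));
  nc_eps : forall k, (1 <= k <= (depth f).-1)%N -> forall i,
    eps <= hadamard (var_sigma z k - const_mx (1 / 2))
                    (affine (var_x z k.-1)) i 0;
  nc_sigma : forall k, (1 <= k <= (depth f).-1)%N -> binary (var_sigma z k);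
  nc_X : X (var_x z 0)
}.

(* The library norm on 'cV[R]_m is the max norm. *)
Definition P_feasible (R : realType) (f : relu_network R)
    (X : set 'cV[R]_(width f 0)) (eps : R) : set (net_var f) :=
  [set z | net_constraints X eps z /\ `|var_y z 0| <= 1].

Definition P_objective (R : realType) (f : relu_network R)
    (z : net_var f) : R := `|var_y z (depth f)|.

Record lifted_var (R : realType) (f : relu_network R) := LiftedVar {
  lifted_net :> net_var f;
  var_u : 'cV[R]_(width f (depth f));
  var_mu : 'cV[R]_(width f (depth f));
  var_eta : 'cV[R]_(width f (depth f))
}.

Record lifted_constraints (R : realType) (f : relu_network R)
    (X : set 'cV[R]_(width f 0)) (eps : R) (z : lifted_var f) : Prop :=
  LiftedConstraints {
  lc_net : net_constraints X eps z;
  lc_y0 : forall i, -1 <= var_y z 0 i 0 <= 1;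
  lc_mu : binary (var_mu z);
  lc_u_ge0 : forall i, 0 <= var_u z i 0;
  lc_u : forall i,
    var_u z i 0 = (2 * var_mu z i 0 - 1) * var_y z (depth f) i 0;
  lc_eta : binary (var_eta z);
  lc_eta_sum : \sum_i var_eta z i 0 = 1
}.

Definition lifted_feasible (R : realType) (f : relu_network R)
    (X : set 'cV[R]_(width f 0)) (eps : R) : set (lifted_var f) :=
  [set z | lifted_constraints X eps z].

Definition lifted_objective (R : realType) (f : relu_network R)
    (z : lifted_var f) : R := \sum_i var_eta z i 0 * var_u z i 0.

(* Main.v *)
Require Import Defs.
From HB Require Import structures.
From mathcomp Require Import all_boot all_order all_algebra.
From mathcomp Require Import all_classical all_reals all_analysis.
Import Order.TTheory GRing.Theory Num.Theory.
Import numFieldNormedType.Exports.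
Local Open Scope classical_set_scope.
Local Open Scope ring_scope.

(** The two problems share the constraints on (y, sigma, x); the bound
    -1 <= y_0 <= 1 is the unit ball of the max norm (lemma [norm_col_le1]), so
    only the objectives differ. Since (2 mu_i - 1) is a sign, u >= 0 forces
    u_i = |(y_L)_i|, and eta is a weight vector of total mass 1, so the lifted
    objective is a weighted mean of the |(y_L)_i|. It is therefore at most
    ||y_L||_oo ([lifted_objective_le]). Conversely the maximum defining
    ||y_L||_oo is attained at some coordinate i, as the output layer is not
    empty; taking the unit vector e_i for eta and the signs of y_L for mu gives
    a lifted point with value exactly ||y_L||_oo ([lift_attaining_norm]).
    Each supremum thus dominates the other, also when both are -oo. *)

Lemma norm_coord_le {R : realType} {m : nat} (v : 'cV[R]_m) i :
  `|v i 0| <= `|v|.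
Proof.
rewrite [leRHS]/Num.norm /= mx_normrE.
by apply/bigmax_geP; right => /=; exists (i, 0).
Qed.

Lemma norm_col_le1 {R : realType} {m : nat} (v : 'cV[R]_m) :
  `|v| <= 1 <-> forall i, -1 <= v i 0 <= 1.
Proof.
split=> [v1 i|v1].
  by rewrite -ler_norml (le_trans (norm_coord_le v i)).
rewrite [leLHS]/Num.norm /= mx_normrE.
by apply/bigmax_leP; split=> // -[i j] _ /=; rewrite ord1 ler_norml.
Qed.

(** For v != 0 this is the maximum of a nonempty finite family; for v = 0 any
    coordinate will do, and [0 < m] provides one. *)
Lemma norm_col_attained {R : realType} {m : nat} (v : 'cV[R]_m) :
  (0 < m)%N -> exists i, `|v| = `|v i 0|.
Proof.
move=> m_gt0; have [->|v_neq0] := eqVneq v 0.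
  by exists (Ordinal m_gt0); rewrite mxE !normr0.
have : mx_norm v != 0 by rewrite -[mx_norm v]/`|v| normr_eq0.
by move=> /mx_norm_neq0[[i j] /= vij]; exists i; rewrite -(ord1 j).
Qed.

Lemma lifted_P_feasible {R : realType} {f : relu_network R}
    {X : set 'cV[R]_(width f 0)} {eps : R} {z : lifted_var f} :
  lifted_feasible X eps z -> P_feasible X eps z.
Proof. by move=> [? ? *]; split=> //; apply/norm_col_le1. Qed.

Lemma lifted_u_le_norm {R : realType} {f : relu_network R}
    {X : set 'cV[R]_(width f 0)} {eps : R} {z : lifted_var f} i :
  lifted_feasible X eps z -> var_u z i 0 <= `|var_y z (depth f) i 0|.
Proof.
move=> [_ _ mu01 _ uE _ _]; rewrite uE.
case: (mu01 i) => ->.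
  by rewrite mulr0 sub0r mulN1r -normrN ler_norm.
by rewrite mulr1 -[2]/(1 + 1) addrK mul1r ler_norm.
Qed.

Lemma lifted_objective_le {R : realType} {f : relu_network R}
    {X : set 'cV[R]_(width f 0)} {eps : R} {z : lifted_var f} :
  lifted_feasible X eps z -> lifted_objective z <= P_objective z.
Proof.
move=> zF; have [_ _ _ _ _ eta01 eta_sum] := zF.
rewrite -[leRHS]mul1r -eta_sum mulr_suml /lifted_objective.
apply: ler_sum => i _; apply: ler_wpM2l.
  by case: (eta01 i) => ->.
exact: le_trans (lifted_u_le_norm i zF) (norm_coord_le _ i).
Qed.

Lemma lift_attaining_norm {R : realType} {f : relu_network R}
    {X : set 'cV[R]_(width f 0)} {eps : R} {z : net_var f} :
  P_feasible X eps z ->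
  exists2 w, lifted_feasible X eps w & lifted_objective w = P_objective z.
Proof.
move=> [zC y0_le1]; set yL := var_y z (depth f).
have [i yLi] := norm_col_attained yL (width_gt0 (leqnn (depth f))).
exists (@LiftedVar _ _ z (\col_j `|yL j 0|) (\col_j (0 <= yL j 0)%R%:R)
  (delta_mx i 0)).
  split=> //=.
  - exact/norm_col_le1.
  - by move=> j; rewrite mxE; case: (0 <= _)%R; [right|left].
  - by move=> j; rewrite mxE.
  - move=> j; rewrite !mxE; case: ger0P => _.
      by rewrite mulr1 -[2]/(1 + 1) addrK mul1r.
    by rewrite mulr0 sub0r mulN1r.
  - by move=> j; rewrite mxE eqxx andbT; case: (j == i); [right|left].
  - rewrite (bigD1 i) //= mxE !eqxx big1 ?addr0 // => j ji.
    by rewrite mxE (negPf ji).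
rewrite /lifted_objective /P_objective -/yL yLi /= (bigD1 i) //= !mxE !eqxx.
rewrite mul1r big1 ?addr0 // => j ji.
by rewrite !mxE (negPf ji) mul0r.
Qed.

Theorem mainTheorem6 (R : realType) (f : relu_network R)
  (X : set 'cV[R]_(width f 0)) (eps : R)
  (X_open : open X) (X_quad : quadratically_expressible X)
  (eps_ge0 : 0 <= eps) :
  optimal_value (P_feasible X eps) (@P_objective R f) =
  optimal_value (lifted_feasible X eps) (@lifted_objective R f).
Proof.
apply/eqP; rewrite eq_le; apply/andP; split; apply: ge_ereal_sup => _ [z zF <-].
  have [w wF <-] := lift_attaining_norm zF.
  by apply: ereal_sup_ubound; exists w.
apply: le_ereal_sup_tmp; exists (P_objective z)%:E.
  by exists (lifted_net z) => //; exact: lifted_P_feasible.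
by rewrite lee_fin (lifted_objective_le zF).
Qed.
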